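(* Consider the translation from $\mathsf{CL}_{\rm b}$ to $\mathsf{CLL}_{\rm b}$ obtained by composing the Kuroda translation $(\cdot)^{\rm Ku}$ with Girard's call-by-name translation $(\cdot)^\circ$, i.e. $A\mapsto(A^{\rm Ku})^\circ$. This composition can be presented directly in a modular (and simpler) way as $A\mapsto\,!?!A_{{\rm Ku}\circ}$, i.e. for every formula $A$ of the language of $\mathsf{ILL}_\bot$ the formulas $(A^{\rm Ku})^\circ$ and $!?!A_{{\rm Ku}\circ}$ are provably equivalent in $\mathsf{CLL}_{\rm b}$, where $A_{{\rm Ku}\circ}$ is defined inductively by: $P_{{\rm Ku}\circ}:=P$ for $P$ atomic; $(A\otimes B)_{{\rm Ku}\circ}:=\,!A_{{\rm Ku}\circ}\otimes\,!B_{{\rm Ku}\circ}$; $(A\& B)_{{\rm Ku}\circ}:=\,!A_{{\rm Ku}\circ}\&\,!B_{{\rm Ku}\circ}$; $(A\oplus B)_{{\rm Ku}\circ}:=\,!A_{{\rm Ku}\circ}\oplus\,!B_{{\rm Ku}\circ}$; $(A\multimap B)_{{\rm Ku}\circ}:=\,!A_{{\rm Ku}\circ}\multimap B_{{\rm Ku}\circ}$; $(\forall xA)_{{\rm Ku}\circ}:=\forall x\,?!A_{{\rm Ku}\circ}$; $(\exists xA)_{{\rm Ku}\circ}:=\exists x\,!A_{{\rm Ku}\circ}$; $(!A)_{{\rm Ku}\circ}:=\,!A_{{\rm Ku}\circ}$.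
   Context: Intuitionistic linear logic $\mathsf{ILL}$ (first order). Formulas are built from atomic formulas, including the constants $1,\top,0$, using $\otimes,\&,\oplus,\multimap$, $\forall x,\exists x$ and $!$. Sequents are $\Gamma\vdash A$ with $\Gamma$ a finite multiset of formulas and exactly one formula on the right. Axioms: $A\vdash A$; $\vdash 1$; $\Gamma\vdash\top$; $\Gamma,0\vdash C$. Rules (premises $\Rightarrow$ conclusion): (cut) $\Gamma\vdash A;\ \Delta,A\vdash C\Rightarrow\Gamma,\Delta\vdash C$; $\Gamma\vdash C\Rightarrow\Gamma,1\vdash C$; $\Gamma\vdash A;\ \Delta\vdash B\Rightarrow\Gamma,\Delta\vdash A\otimes B$; $\Gamma,A,B\vdash C\Rightarrow\Gamma,A\otimes B\vdash C$; $\Gamma,A\vdash B\Rightarrow\Gamma\vdash A\multimap B$; $\Gamma\vdash A;\ \Delta,B\vdash C\Rightarrow\Gamma,\Delta,A\multimap B\vdash C$; $\Gamma\vdash A;\ \Gamma\vdash B\Rightarrow\Gamma\vdash A\& B$; $\Gamma,A\vdash C\Rightarrow\Gamma,A\& B\vdash C$; $\Gamma,B\vdash C\Rightarrow\Gamma,A\& B\vdash C$; $\Gamma\vdash A\Rightarrow\Gamma\vdash A\oplus B$; $\Gamma\vdash B\Rightarrow\Gamma\vdash A\oplus B$; $\Gamma,A\vdash C;\ \Gamma,B\vdash C\Rightarrow\Gamma,A\oplus B\vdash C$; $\Gamma\vdash A\Rightarrow\Gamma\vdash\forall xA$; $\Gamma,A[t/x]\vdash C\Rightarrow\Gamma,\forall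 xA\vdash C$; $\Gamma\vdash A[t/x]\Rightarrow\Gamma\vdash\exists xA$; $\Gamma,A\vdash C\Rightarrow\Gamma,\exists xA\vdash C$ (usual eigenvariable conditions); $\Gamma,!A,!A\vdash C\Rightarrow\Gamma,!A\vdash C$; $\Gamma\vdash C\Rightarrow\Gamma,!A\vdash C$; $!\Gamma\vdash A\Rightarrow\,!\Gamma\vdash\,!A$; $\Gamma,A\vdash C\Rightarrow\Gamma,!A\vdash C$. $\mathsf{ILL}_\bot$ extends $\mathsf{ILL}$ by one more constant $\bot$ (also counted as atomic); its sequents have at most one formula on the right (so $C$ in the rules above may be absent), and it has the additional axiom $\bot\vdash$ and rule $\Gamma\vdash\ \Rightarrow\Gamma\vdash\bot$. $\neg A:=A\multimap\bot$ and $?A:=\neg\,!\,\neg A$. $\mathsf{PRO}$: $A\vdash\,!A$; $\mathsf{DNE}$: $\neg\neg A\vdash A$ (axiom schemas). $\mathsf{CLL}_{\rm b}:=\mathsf{ILL}_\bot+\mathsf{DNE}$; $\mathsf{CL}_{\rm b}:=\mathsf{ILL}_\bot+\mathsf{PRO}+\mathsf{DNE}$. Formulas $A,B$ are provably equivalent in $S$ if $S$ proves $(A\multimap B)\&(B\multimap A)$. Kuroda translation: $A^{\rm Ku}:=\neg\neg A_{\rm Ku}$ where $P_{\rm Ku}:=P$ ($P$ atomic); $(A\,\square\,B)_{\rm Ku}:=A_{\rm Ku}\,\square\,B_{\rm Ku}$ for $\square\in\{\otimes,\&,\oplus,\multimap\}$; $(\forall xA)_{\rm Ku}:=\forall x\,\neg\neg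 A_{\rm Ku}$; $(\exists xA)_{\rm Ku}:=\exists xA_{\rm Ku}$; $(!A)_{\rm Ku}:=\,!A_{\rm Ku}$. Call-by-name translation: $A^\circ:=\,!A_\circ$ where $P_\circ:=P$ ($P$ atomic); $(A\otimes B)_\circ:=\,!A_\circ\otimes\,!B_\circ$; $(A\& B)_\circ:=A_\circ\& B_\circ$; $(A\oplus B)_\circ:=\,!A_\circ\oplus\,!B_\circ$; $(A\multimap B)_\circ:=\,!A_\circ\multimap B_\circ$; $(\forall xA)_\circ:=\forall xA_\circ$; $(\exists xA)_\circ:=\exists x\,!A_\circ$; $(!A)_\circ:=\,!A_\circ$. *)

(* Defs.v *)
From Stdlib Require Vector.
From Stdlib Require Import List Permutation.
Import ListNotations.

Set Implicit Arguments.
Unset Strict Implicit.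

(** Bound variables are de Bruijn indices, so that formulas are identified up
    to renaming of bound variables and substitution is capture-avoiding. *)

Record signature := Signature {
  func : Type;
  func_arity : func -> nat;
  rel : Type;
  rel_arity : rel -> nat
}.

Inductive term (L : signature) : Type :=
| Var (n : nat)
| Fun (f : func L) (ts : Vector.t (term L) (func_arity f)).

Arguments Var {L} n.

(** [Bot] is the constant that ILL_bot adds to the language of ILL. *)
Inductive form (L : signature) : Type :=
| Atom (P : rel L) (ts : Vector.t (term L) (rel_arity P))
| One
| Top
| Zero
| Bot
| Tensor (A B : form L)
| With (A B : form L)
| Plus (A B : form L)
| Limp (A B : form L)
| All (A : form L)
| Ex (A : form L)
| Bang (A : form L).

Arguments One {L}.
Arguments Top {L}.
Arguments Zero {L}.
Arguments Bot {L}.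

Declare Scope ill_scope.
Delimit Scope ill_scope with ill.
Bind Scope ill_scope with form.
Notation "A ⊸ B" := (Limp A B) (at level 60, right associativity) : ill_scope.
Notation "A ⊗ B" := (Tensor A B) (at level 50, left associativity) : ill_scope.
Notation "A ⊕ B" := (Plus A B) (at level 50, left associativity) : ill_scope.
Notation "A & B" := (With A B) (at level 50, left associativity) : ill_scope.
Local Open Scope ill_scope.

Definition neg L (A : form L) : form L := A ⊸ Bot.
Definition WhyNot L (A : form L) : form L := neg (Bang (neg A)).

Fixpoint subst_term L (s : nat -> term L) (t : term L) : term L :=
  match t with
  | Var n => s n
  | Fun ts => Fun (Vector.map (subst_term s) ts)
  end.

Definition shift L (n : nat) : term L := Var (S n).

(** Push a substitution under a binder. *)
Definition up L (s : nat -> term L) (n : nat) : term L :=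
  match n with
  | 0 => Var 0
  | S m => subst_term (@shift L) (s m)
  end.

Fixpoint subst L (s : nat -> term L) (A : form L) : form L :=
  match A with
  | Atom ts => Atom (Vector.map (subst_term s) ts)
  | One => One
  | Top => Top
  | Zero => Zero
  | Bot => Bot
  | A ⊗ B => subst s A ⊗ subst s B
  | A & B => subst s A & subst s B
  | A ⊕ B => subst s A ⊕ subst s B
  | A ⊸ B => subst s A ⊸ subst s B
  | All A => All (subst (up s) A)
  | Ex A => Ex (subst (up s) A)
  | Bang A => Bang (subst s A)
  end.

(** [inst t A] is A[t/x], where [x] is the variable bound by the quantifier
    that was in front of [A]; the other free variables move down by one. *)
Definition inst L (t : term L) (A : form L) : form L :=
  subst (fun n => match n with 0 => t | S m => Var m end) A.

(** Weakening by a fresh variable: index 0 does not occur in [lift A], which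
    is how the eigenvariable conditions of [p_allR] and [p_exL] are enforced. *)
Definition lift L (A : form L) : form L := subst (@shift L) A.

(** [prov Ax G C]: the sequent with antecedent [G] and succedent [C] is
    derivable in ILL_bot extended by the axioms [A |- B] for [Ax A B].
    Antecedents are multisets, i.e. lists up to permutation ([p_exch]);
    [C = None] is the empty succedent. *)
Inductive prov L (Ax : form L -> form L -> Prop) :
    list (form L) -> option (form L) -> Prop :=
| p_exch G D C : Permutation G D -> prov Ax G C -> prov Ax D C
| p_extra A B : Ax A B -> prov Ax [A] (Some B)
| p_id A : prov Ax [A] (Some A)
| p_cut G D A C :
    prov Ax G (Some A) -> prov Ax (A :: D) C -> prov Ax (G ++ D) C
| p_oneR : prov Ax [] (Some One)
| p_oneL G C : prov Ax G C -> prov Ax (One :: G) C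
| p_topR G : prov Ax G (Some Top)
| p_zeroL G C : prov Ax (Zero :: G) C
| p_botL : prov Ax [Bot] None
| p_botR G : prov Ax G None -> prov Ax G (Some Bot)
| p_tensorR G D A B :
    prov Ax G (Some A) -> prov Ax D (Some B) -> prov Ax (G ++ D) (Some (A ⊗ B))
| p_tensorL G A B C : prov Ax (A :: B :: G) C -> prov Ax (A ⊗ B :: G) C
| p_limpR G A B : prov Ax (A :: G) (Some B) -> prov Ax G (Some (A ⊸ B))
| p_limpL G D A B C :
    prov Ax G (Some A) -> prov Ax (B :: D) C -> prov Ax ((A ⊸ B) :: G ++ D) C
| p_withR G A B :
    prov Ax G (Some A) -> prov Ax G (Some B) -> prov Ax G (Some (A & B))
| p_withL1 G A B C : prov Ax (A :: G) C -> prov Ax (A & B :: G) C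
| p_withL2 G A B C : prov Ax (B :: G) C -> prov Ax (A & B :: G) C
| p_plusR1 G A B : prov Ax G (Some A) -> prov Ax G (Some (A ⊕ B))
| p_plusR2 G A B : prov Ax G (Some B) -> prov Ax G (Some (A ⊕ B))
| p_plusL G A B C :
    prov Ax (A :: G) C -> prov Ax (B :: G) C -> prov Ax (A ⊕ B :: G) C
| p_allR G A : prov Ax (map (@lift L) G) (Some A) -> prov Ax G (Some (All A))
| p_allL G A t C : prov Ax (inst t A :: G) C -> prov Ax (All A :: G) C
| p_exR G A t : prov Ax G (Some (inst t A)) -> prov Ax G (Some (Ex A))
| p_exL G A C :
    prov Ax (A :: map (@lift L) G) (option_map (@lift L) C) ->
    prov Ax (Ex A :: G) C
| p_contr G A C : prov Ax (Bang A :: Bang A :: G) C -> prov Ax (Bang A :: G) C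
| p_weak G C A : prov Ax G C -> prov Ax (Bang A :: G) C
| p_bangR G A :
    prov Ax (map (@Bang L) G) (Some A) ->
    prov Ax (map (@Bang L) G) (Some (Bang A))
| p_bangL G A C : prov Ax (A :: G) C -> prov Ax (Bang A :: G) C.

Inductive DNE L : form L -> form L -> Prop :=
| dne A : DNE (neg (neg A)) A.

Definition CLLb L : list (form L) -> option (form L) -> Prop := prov (@DNE L).

Definition prov_equiv L (T : list (form L) -> option (form L) -> Prop)
    (A B : form L) : Prop :=
  T [] (Some ((A ⊸ B) & (B ⊸ A))).

(** Kuroda translation: [Ku_in] is the inner translation (subscript Ku) and
    [Ku] the outer one (superscript Ku). *)
Fixpoint Ku_in L (A : form L) : form L :=
  match A with
  | Atom _ | One | Top | Zero | Bot => A
  | A ⊗ B => Ku_in A ⊗ Ku_in B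
  | A & B => Ku_in A & Ku_in B
  | A ⊕ B => Ku_in A ⊕ Ku_in B
  | A ⊸ B => Ku_in A ⊸ Ku_in B
  | All A => All (neg (neg (Ku_in A)))
  | Ex A => Ex (Ku_in A)
  | Bang A => Bang (Ku_in A)
  end.

Definition Ku L (A : form L) : form L := neg (neg (Ku_in A)).

(** Girard's call-by-name translation: [cbn_in] is the inner translation
    (subscript circle) and [cbn] the outer one (superscript circle). *)
Fixpoint cbn_in L (A : form L) : form L :=
  match A with
  | Atom _ | One | Top | Zero | Bot => A
  | A ⊗ B => Bang (cbn_in A) ⊗ Bang (cbn_in B)
  | A & B => cbn_in A & cbn_in B
  | A ⊕ B => Bang (cbn_in A) ⊕ Bang (cbn_in B)
  | A ⊸ B => Bang (cbn_in A) ⊸ cbn_in B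
  | All A => All (cbn_in A)
  | Ex A => Ex (Bang (cbn_in A))
  | Bang A => Bang (cbn_in A)
  end.

Definition cbn L (A : form L) : form L := Bang (cbn_in A).

(** The direct presentation (subscript Ku circle) of the composition. *)
Fixpoint Ku_cbn_in L (A : form L) : form L :=
  match A with
  | Atom _ | One | Top | Zero | Bot => A
  | A ⊗ B => Bang (Ku_cbn_in A) ⊗ Bang (Ku_cbn_in B)
  | A & B => Bang (Ku_cbn_in A) & Bang (Ku_cbn_in B)
  | A ⊕ B => Bang (Ku_cbn_in A) ⊕ Bang (Ku_cbn_in B)
  | A ⊸ B => Bang (Ku_cbn_in A) ⊸ Ku_cbn_in B
  | All A => All (WhyNot (Bang (Ku_cbn_in A)))
  | Ex A => Ex (Bang (Ku_cbn_in A))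
  | Bang A => Bang (Ku_cbn_in A)
  end.

(* Main.v *)
Require Import Defs.
From Stdlib Require Vector.
From Stdlib Require Import List Permutation.
Import ListNotations.
Local Open Scope ill_scope.

(** Unfolding the definitions, [cbn (Ku A)] is [!?!X] with [X := cbn_in (Ku_in A)],
    and [X] differs from [Ku_cbn_in A] only in that the latter puts [!] on the
    components of [&]. The two need not be equivalent, but their
    exponentials [!X] and [!(Ku_cbn_in A)] are, by induction on [A]; the case of
    [⊸] uses that from [!(!A ⊸ B)] and [!A] one derives not only [B] but [!B]. *)

Section Substitution.

Context {L : signature}.
Implicit Types (s r u : nat -> term L) (t : term L) (A : form L).

(* The automatically generated principle has no hypothesis for the arguments
   of a function symbol, which are nested inside a vector. *)
Lemma term_nested_ind (P : term L -> Prop) :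
  (forall n, P (Var n)) ->
  (forall f (ts : Vector.t (term L) (func_arity f)),
     Vector.Forall P ts -> P (Fun ts)) ->
  forall t, P t.
Proof.
  intros HV HF. fix IH 1. intros [n|f ts].
  - apply HV.
  - apply HF. induction ts as [|t n ts IHts]; constructor; [apply IH | exact IHts].
Qed.

Lemma subst_term_comp s r u t :
  (forall n, subst_term r (s n) = u n) ->
  subst_term r (subst_term s t) = subst_term u t.
Proof.
  intros H. induction t as [n|f ts IH] using term_nested_ind; simpl; [apply H|].
  f_equal. induction IH as [|k t ts Ht _ IH]; simpl; congruence.
Qed.

Lemma subst_term_Var s t : (forall n, s n = Var n) -> subst_term s t = t.
Proof.
  intros H. induction t as [n|f ts IH] using term_nested_ind; simpl; [apply H|].
  f_equal. induction IH as [|k t ts Ht _ IH]; simpl; congruence.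
Qed.

Lemma up_cancel s r :
  (forall n, subst_term r (s n) = Var n) ->
  forall n, subst_term (up r) (up s n) = Var n.
Proof.
  intros H [|n]; [reflexivity|]. simpl.
  (* [up r] after [shift] acts as [shift] after [r], which brings [r] next to [s]. *)
  rewrite subst_term_comp with (u := fun m => subst_term (@shift L) (r m))
    by reflexivity.
  rewrite <- subst_term_comp with (s := r) (r := @shift L) by reflexivity.
  now rewrite H.
Qed.

Lemma subst_cancel A : forall s r,
  (forall n, subst_term r (s n) = Var n) -> subst r (subst s A) = A.
Proof.
  induction A; intros s r H; simpl; f_equal; auto using up_cancel.
  induction ts as [|t n ts IH]; simpl; [reflexivity|].
  rewrite IH, (subst_term_comp s r Var t H), subst_term_Var; auto.
Qed.

(** For the quantifier rules: an eigenvariable step lifts the formula on the other side, and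
    instantiating its body at the eigenvariable [Var 0] undoes the lift. *)
Lemma inst_Var0_lift A : inst (Var 0) (subst (up (@shift L)) A) = A.
Proof. apply subst_cancel. now intros [|n]. Qed.

End Substitution.

Section Entailment.

Context {L : signature} (Ax : form L -> form L -> Prop).
Implicit Types A B C : form L.

Lemma prov_cut1 A B C :
  prov Ax [A] (Some B) -> prov Ax [B] (Some C) -> prov Ax [A] (Some C).
Proof. intros H1 H2. exact (p_cut H1 H2). Qed.

Lemma neg_anti A B :
  prov Ax [A] (Some B) -> prov Ax [neg B] (Some (neg A)).
Proof.
  intros H. apply p_limpR. apply p_exch with (G := [neg B; A]); [constructor|].
  exact (p_limpL H (p_id Ax Bot)).
Qed.

(** Co-Kleisli entailment for [!]; by promotion and dereliction it amounts to deriving [Bang B] from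
    [Bang A]. *)
Definition bang_entails A B : Prop := prov Ax [Bang A] (Some B).

Lemma entails_bang A B : prov Ax [A] (Some B) -> bang_entails A B.
Proof. apply p_bangL. Qed.

Lemma bang_entails_promote A B :
  bang_entails A B -> prov Ax [Bang A] (Some (Bang B)).
Proof. exact (@p_bangR L Ax [A] B). Qed.

(** [?!] is [neg], [!], [neg], [!] in turn: each [neg] reverses the entailment, and promotion
    carries it through each [!]. The result is a plain entailment, as [bang_entails_All]
    requires. *)
Lemma WhyNot_Bang_mono A B :
  bang_entails A B ->
  prov Ax [WhyNot (Bang A)] (Some (WhyNot (Bang B))).
Proof.
  intros H. apply neg_anti, bang_entails_promote, entails_bang.
  now apply neg_anti, bang_entails_promote.
Qed.

Lemma bang_entails_Tensor A A' B B' :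
  bang_entails A A' -> bang_entails B B' ->
  bang_entails (Bang A ⊗ Bang B) (Bang A' ⊗ Bang B').
Proof.
  intros HA HB. apply entails_bang, p_tensorL.
  exact (p_tensorR (bang_entails_promote _ _ HA) (bang_entails_promote _ _ HB)).
Qed.

Lemma bang_entails_Plus A A' B B' :
  bang_entails A A' -> bang_entails B B' ->
  bang_entails (Bang A ⊕ Bang B) (Bang A' ⊕ Bang B').
Proof.
  intros HA HB. apply entails_bang, p_plusL.
  - now apply p_plusR1, bang_entails_promote.
  - now apply p_plusR2, bang_entails_promote.
Qed.

Lemma bang_entails_With_Bang A A' B B' :
  bang_entails A A' -> bang_entails B B' ->
  bang_entails (A & B) (Bang A' & Bang B').
Proof.
  intros HA HB. apply p_withR; apply bang_entails_promote.
  (* Under the outer [!] the projection of [A & B] can itself be promoted, which supplies the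
     [Bang A] that [HA] needs. *)
  - apply prov_cut1 with (Bang A); [|exact HA].
    apply bang_entails_promote, entails_bang, p_withL1, p_id.
  - apply prov_cut1 with (Bang B); [|exact HB].
    apply bang_entails_promote, entails_bang, p_withL2, p_id.
Qed.

Lemma bang_entails_Bang_With A A' B B' :
  bang_entails A A' -> bang_entails B B' ->
  bang_entails (Bang A & Bang B) (A' & B').
Proof.
  intros HA HB. apply entails_bang, p_withR.
  - now apply p_withL1.
  - now apply p_withL2.
Qed.

Lemma bang_entails_Limp A A' B B' :
  bang_entails A' A -> bang_entails B B' ->
  bang_entails (Bang A ⊸ B) (Bang A' ⊸ B').
Proof.
  intros HA HB. apply p_limpR.
  (* The cut formula is [Bang B]: both hypotheses carry [!], so the [B] they yield can be
     promoted. *)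
  refine (p_cut (G := [Bang A'; Bang (Bang A ⊸ B)]) (D := []) _ HB).
  apply (@p_bangR L Ax [A'; Bang A ⊸ B]); simpl.
  apply p_exch with (G := [Bang (Bang A ⊸ B); Bang A']); [constructor|].
  apply p_bangL.
  exact (p_limpL (bang_entails_promote _ _ HA) (p_id Ax B)).
Qed.

Lemma bang_entails_All A B :
  prov Ax [A] (Some B) -> bang_entails (All A) (All B).
Proof.
  intros H. apply p_allR, p_bangL. apply p_allL with (t := Var 0).
  now rewrite inst_Var0_lift.
Qed.

Lemma bang_entails_Ex A B :
  prov Ax [A] (Some B) -> bang_entails (Ex A) (Ex B).
Proof.
  intros H. apply p_bangL, p_exL. apply p_exR with (t := Var 0).
  now rewrite inst_Var0_lift.
Qed.

(** Both directions go through one induction because [⊸] is contravariant on the left. *)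
Lemma Ku_cbn_in_bang_equiv A :
  bang_entails (cbn_in (Ku_in A)) (Ku_cbn_in A) /\
  bang_entails (Ku_cbn_in A) (cbn_in (Ku_in A)).
Proof.
  induction A;
    repeat match goal with H : _ /\ _ |- _ => destruct H end;
    split; simpl; try apply entails_bang, p_id;
    auto using bang_entails_Tensor, bang_entails_Plus, bang_entails_With_Bang,
      bang_entails_Bang_With, bang_entails_Limp, bang_entails_Ex,
      bang_entails_promote, entails_bang.
  (* The [∀] cases: [cbn_in] turns the double negation inserted by [Ku_in] into exactly [?!]. *)
  all: now apply bang_entails_All, WhyNot_Bang_mono.
Qed.

End Entailment.

Theorem theorem3 (L : signature) (A : form L) :
  prov_equiv (@CLLb L)
    (cbn (Ku A))
    (Bang (WhyNot (Bang (Ku_cbn_in A)))).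
Proof.
  destruct (Ku_cbn_in_bang_equiv (@DNE L) A) as [H1 H2].
  apply p_withR; apply p_limpR;
    apply bang_entails_promote, entails_bang; now apply WhyNot_Bang_mono.
Qed.
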